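(* Let $m$ be a positive integer, $q=2^m$, and $F=\mathbb{F}_q$. Let $c\in F$ and let $n$ be a rational number such that $c^n$ is an element of $F$. Suppose that $c^{4n}+1\neq 0$ and that the two arguments of $K$ below are nonzero. Then $$K\left(\frac{(c^{n+1}+c^{n})^{3}(c^{n+1}+1)}{c^{4n}+1}\right)=K\left(\frac{(c^{n+1}+c^{n})(c^{n+1}+1)^{3}}{c^{4n}+1}\right).$$
   Context: $F=\mathbb{F}_q$ is the finite field with $q=2^m$ elements, $F^*=F\setminus\{0\}$, and $\mathrm{Tr}$ is the absolute trace function of $F$ over $\mathbb{F}_2$. For $a\in F^*$ the Kloosterman sum is $K(a)=\sum_{x\in F^*}(-1)^{\mathrm{Tr}(ax+1/x)}$. Rational powers: for $n=r/s$ in lowest terms with $s>0$, $c^n$ denotes a fixed element $d\in F$ with $d^s=c^r$ (with $c\neq 0$ if $r<0$, and $c^0=1$); then $c^{n+1}=c\cdot c^n$ and $c^{4n}=(c^n)^4$. *)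

(* Defs.v *)
From mathcomp Require Import all_boot all_order all_fingroup all_algebra all_solvable all_field.

Set Implicit Arguments.
Unset Strict Implicit.
Unset Printing Implicit Defensive.

Import GRing.Theory.

Local Open Scope ring_scope.

(* The absolute trace of a field F with 2 ^ m elements over its prime field,
   x + x ^ 2 + x ^ 4 + ... + x ^ (2 ^ (m - 1)), as an element of F.  Lemma
   abs_traceE identifies it with the Galois trace over 'F_2. *)
Definition abs_trace (m : nat) (F : finFieldType) (x : F) : F :=
  \sum_(i < m) x ^+ (2 ^ i).

(* abs_trace m x is 0 or 1 in F (abs_trace_F2), so the exponent of -1 is its
   representative in {0, 1}, given by the boolean abs_trace m x != 0. *)
Definition kloosterman (m : nat) (F : finFieldType) (a : F) : int :=
  \sum_(x : F | x != 0) (-1) ^+ (abs_trace m (a * x + x^-1) != 0).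

(* d is a value of c ^ n: for n = r / s in lowest terms with s > 0,
   d ^ s = c ^ r, where c must be nonzero if r < 0. *)
Definition is_ratpow (F : fieldType) (c : F) (n : rat) (d : F) : Prop :=
  (numq n < 0 -> c != 0) /\ d ^ denq n = c ^ numq n.

Lemma abs_trace_F2 (m : nat) (F : finFieldType) (x : F) :
  #|F| = (2 ^ m)%N -> abs_trace m x = 0 \/ abs_trace m x = 1.
Proof.
move=> cardF; have char2 := card_finPcharP cardF isT.
have frob : abs_trace m x ^+ 2 = abs_trace m x.
  rewrite -(pFrobenius_autE char2) rmorph_sum /=.
  under eq_bigr => i _ do rewrite pFrobenius_autE -exprM -expnSr.
  apply: (addIr (x ^+ (2 ^ 0))); rewrite addrC.
  rewrite -(big_ord_recl m (fun i => x ^+ (2 ^ i))) big_ord_recr /=.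
  by rewrite -cardF expf_card expr1.
have /eqP : abs_trace m x * (abs_trace m x - 1) = 0.
  by rewrite mulrBr mulr1 -expr2 frob subrr.
by rewrite mulf_eq0 subr_eq0 => /orP[] /eqP ->; [left | right].
Qed.

Lemma abs_traceE (m : nat) (F : finFieldType) (char2 : 2%N \in [pchar F]) (x : F) :
  #|F| = (2 ^ m)%N ->
  abs_trace m x = galTrace 1%VS {: pPrimeCharType char2} x.
Proof.
move=> cardF; set L := pPrimeCharType char2.
have [a gen_a Da] := finField_galois_generator (sub1v {: L}).
have {}Da y : a y = y ^+ 2 :> L.
  rewrite Da ?memvf //; congr (_ ^+ _).
  by rewrite dimv1 expn1 card_Fp.
have Dai i : (a ^+ i)%g x = x ^+ (2 ^ i) :> L.
  elim: i => [|i IHi]; first by rewrite expg0 gal_id expr1.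
  by rewrite expgSr galM ?memvf // IHi Da -exprM -expnSr.
have ord_a : #[a]%g = m.
  rewrite orderE -(eqP gen_a) -galois_dim; last exact/finField_galois/sub1v.
  by rewrite dimv1 divn1 pprimeChar_dimf cardF pfactorK.
have inj_a : injective (fun i : 'I_m => a ^+ i)%g.
  move=> i j /eqP; rewrite eq_expg_mod_order ord_a !modn_small //.
  by move/eqP/val_inj.
have im_a : ('Gal({: L} / 1%VS))%g = [set (a ^+ i)%g | i : 'I_m].
  rewrite (eqP gen_a); apply/setP=> y; apply/idP/imsetP => [/cyclePmin | ].
    by case=> i; rewrite ord_a => lt_i_m ->; exists (Ordinal lt_i_m).
  by case=> i _ ->; apply: mem_cycle.
rewrite /galTrace im_a big_imset /=; last by move=> i j _ _; apply: inj_a.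
by apply: eq_bigr => i _; rewrite Dai.
Qed.

(* Main.v *)
Require Import Defs.
From mathcomp Require Import all_boot all_order all_fingroup all_algebra all_solvable all_field.
From mathcomp Require Import ring.

Set Implicit Arguments.
Unset Strict Implicit.
Unset Printing Implicit Defensive.

Import GRing.Theory.

Local Open Scope ring_scope.

(** With [a = c cn + cn] and [b = c cn + 1] one has [a + b = cn + 1], so that
for [t = a / (a + b)] the two arguments are [A = t^3 (t + 1)] and
[B = t (t + 1)^3].  The equality K(A) = K(B) of Helleseth and Zinoviev comes
from an isogeny of degree 3.

Let chi be the character x |-> (-1)^Tr(x).  Substituting y^-2 for the variable
gives K(A) = sum of chi(x + A / x^2) over nonzero x ([kloostermanE]), which
counts the points of the elliptic curve y^2 + xy = x^3 + A.  Its 3-division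
polynomial is x^4 + x^3 + A, which vanishes at x = t; Velu's formulas for the
subgroup of order 3 with abscissa t give, on abscissas, the map
  phi(x) = x (x^2 + t^2 + t) / (x + t)^2
onto the curve with parameter B, and indeed chi(phi(x) + B / phi(x)^2) =
chi(x + A / x^2) ([trace_char_isog]).  Write g(y) = chi(y + B / y^2), s for the
square root of t^2 + t, and N(y) for the number of x outside {0, s, t} with
phi(x) = y.  Then
  K(A) - K(B) = 2 chi(t) + sum over y != 0 of g(y) (N(y) - 1),
because x + A / x^2 has the same trace as t at x = s and at x = t.

The Galois closure of phi has group S_3 with the curve B itself, twisted by t,
as its quadratic resolvent.  Hence N(y) = 1 whenever g(y) != chi(t), which means
that g(y) (N(y) - 1) = chi(t) (N(y) - 1) for all y ([isog_fiber_count]).  The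
sum is thus chi(t) times the sum of N(y) - 1, that is
chi(t) ((q - 3) - (q - 1)) = - 2 chi(t).

The arithmetic input is the classical fact that a cubic z^3 + a z + b with
b != 0 and Tr(1 + a^3 / b^2) = 1 has exactly one root ([cubic_unique_root]). *)

(** * Polynomial identities in characteristic 2 *)

Lemma odd_natr_char2 (R : pzRingType) (k : nat) : 2%:R = 0 :> R -> k%:R = (odd k)%:R :> R.
Proof.
by move=> two0; rewrite -{1}[k]odd_double_half natrD -mul2n natrM two0 mul0r addr0.
Qed.

(** The tactics [ring] and [field] rewrite by a hypothesis [k%:R = e] only the
monomials whose coefficient is exactly [k], so reduction modulo 2 needs one
equation for each coefficient that occurs. *)
Lemma coefs_char2 (R : pzRingType) : 2%:R = 0 :> R ->
  [/\ 3%:R = 1 :> R, 4%:R = 0 :> R, 5%:R = 1 :> R & 6%:R = 0 :> R]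
  /\ [/\ 7%:R = 1 :> R, 8%:R = 0 :> R, 9%:R = 1 :> R & 10%:R = 0 :> R].
Proof. by move=> two0; do !split; apply: odd_natr_char2. Qed.

Ltac char2_ring two0 :=
  let e3 := fresh in let e4 := fresh in let e5 := fresh in let e6 := fresh in
  let e7 := fresh in let e8 := fresh in let e9 := fresh in let e10 := fresh in
  have [[e3 e4 e5 e6] [e7 e8 e9 e10]] := coefs_char2 two0;
  ring: two0 e3 e4 e5 e6 e7 e8 e9 e10.

Ltac char2_field two0 :=
  let e3 := fresh in let e4 := fresh in let e5 := fresh in let e6 := fresh in
  let e7 := fresh in let e8 := fresh in let e9 := fresh in let e10 := fresh in
  have [[e3 e4 e5 e6] [e7 e8 e9 e10]] := coefs_char2 two0;
  field: two0 e3 e4 e5 e6 e7 e8 e9 e10.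

(** * The trace character *)

Section Char2.

Variables (m : nat) (F : finFieldType).
Hypothesis cardF : #|F| = (2 ^ m)%N.

Let pchar2 : 2%N \in [pchar F] := card_finPcharP cardF isT.

Lemma char2 : 2%:R = 0 :> F.
Proof. exact: pcharf0. Qed.

Lemma addr_eq0_char2 (x y : F) : (x + y == 0) = (x == y).
Proof. by rewrite addr_eq0 (oppr_pchar2 pchar2). Qed.

Lemma sqr_inj_char2 : injective (fun x : F => x ^+ 2).
Proof. by move=> x y /= xy; apply: (fmorph_inj (pFrobenius_aut pchar2)). Qed.

Lemma sqrt_char2 (x : F) : {s : F | s ^+ 2 = x}.
Proof.
by exists (invF sqr_inj_char2 x); apply: (f_invF sqr_inj_char2).
Qed.

Definition trace_char (x : F) : int := (-1) ^+ (abs_trace m x != 0).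

Lemma abs_traceD (x y : F) : abs_trace m (x + y) = abs_trace m x + abs_trace m y.
Proof.
rewrite -big_split; apply: eq_bigr => i _ /=.
by rewrite exprDn_pchar // pnatX pnatE // pchar2.
Qed.

Lemma abs_trace_sqr (x : F) : abs_trace m (x ^+ 2) = abs_trace m x.
Proof.
apply: (addIr (x ^+ (2 ^ 0))); rewrite /abs_trace [LHS]addrC.
under eq_bigr => i _ do rewrite -exprM -expnS.
rewrite -(big_ord_recl m (fun i => x ^+ (2 ^ i))) big_ord_recr /=.
by rewrite -cardF expf_card expr1.
Qed.

Lemma trace_charD (x y : F) : trace_char (x + y) = trace_char x * trace_char y.
Proof.
rewrite /trace_char abs_traceD -signr_addb; congr (_ ^+ nat_of_bool _).
have [->|->] := abs_trace_F2 x cardF; have [->|->] := abs_trace_F2 y cardF;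
  by rewrite ?addr0 ?add0r ?(addrr_pchar2 pchar2) ?eqxx ?oner_eq0.
Qed.

Lemma trace_char_sqr (x : F) : trace_char (x ^+ 2) = trace_char x.
Proof. by rewrite /trace_char abs_trace_sqr. Qed.

Lemma trace_charMM (x : F) : trace_char x * trace_char x = 1.
Proof. by rewrite /trace_char; case: eqP. Qed.

(** Elements w^2 + w have trace 0; two elements are shown to have the same trace
by exhibiting their difference in this form. *)
Lemma trace_char_addAS (x w : F) : trace_char (x + (w ^+ 2 + w)) = trace_char x.
Proof. by rewrite !trace_charD trace_char_sqr trace_charMM mulr1. Qed.

Lemma trace_char_AS (w : F) : trace_char (w ^+ 2 + w) = 1.
Proof. by rewrite trace_charD trace_char_sqr trace_charMM. Qed.

Lemma trace_char_eq (x y : F) : trace_char (x + y) = 1 -> trace_char x = trace_char y.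
Proof.
rewrite trace_charD => xy.
by rewrite -[LHS]mulr1 -(trace_charMM y) mulrA xy mul1r.
Qed.

(** Substituting y^-2 for x turns the summand chi(a x + 1/x) into
chi(a / y^2 + y^2), and Tr(y^2) = Tr(y). *)
Lemma kloostermanE (a : F) :
  kloosterman m a = \sum_(x : F | x != 0) trace_char (x + a / x ^+ 2).
Proof.
pose h (x : F) := (x ^+ 2)^-1.
have h_inj : injective h by move=> x y /invr_inj /sqr_inj_char2.
rewrite [LHS](reindex_inj h_inj) /=.
apply: eq_big => [x|x _]; first by rewrite invr_eq0 sqrf_eq0.
by rewrite -/(trace_char _) /h invrK addrC !trace_charD trace_char_sqr.
Qed.

(** * Cubics with exactly one root *)

(** With k = a / r^2 and b = r^3 + a r the two arguments differ by
k^3 / (1 + k)^2 + k = 1 / (1 + k)^2 + 1 / (1 + k).  So the resolvent of the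
cubic z^3 + a z + b can be computed from any of its roots r. *)
Lemma cubic_root_trace (a r : F) : r ^+ 3 + a * r != 0 ->
  trace_char (1 + a ^+ 3 / (r ^+ 3 + a * r) ^+ 2) = trace_char (1 + a / r ^+ 2).
Proof.
set q := r ^+ 2 + a; have -> : r ^+ 3 + a * r = r * q by rewrite /q; ring.
have -> : a = q + r ^+ 2 by rewrite /q; char2_ring char2.
rewrite mulf_eq0 negb_or => /andP[r0 q0].
rewrite -(trace_char_addAS (1 + _ / _) (r ^+ 2 / q)); congr trace_char.
by char2_field char2; rewrite r0 q0.
Qed.

(** A second root s satisfies s^2 + s r + r^2 + a = 0; divided by r^2, this
exhibits 1 + a / r^2 as w^2 + w with w = s / r. *)
Lemma cubic_two_roots_trace (a r s : F) : r != 0 -> s != r ->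
  s ^+ 3 + a * s = r ^+ 3 + a * r -> trace_char (1 + a / r ^+ 2) = 1.
Proof.
move=> r0 nsr /eqP; rewrite -addr_eq0_char2.
have -> : s ^+ 3 + a * s + (r ^+ 3 + a * r) = (s + r) * (s ^+ 2 + s * r + r ^+ 2 + a).
  by char2_ring char2.
rewrite mulf_eq0 addr_eq0_char2 (negPf nsr) /= => /eqP q0.
rewrite -(trace_char_AS (s / r)); congr trace_char.
apply/eqP; rewrite -addr_eq0_char2; apply/eqP.
rewrite [LHS](_ : _ = (s ^+ 2 + s * r + r ^+ 2 + a) / r ^+ 2); last by field.
by rewrite q0 mul0r.
Qed.

(** Existence of the root comes from a count.  Let U be the set of nonzero r with
Tr(1 + a / r^2) = 1 and V the set of nonzero d with Tr(1 + a^3 / d^2) = 1.  The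
map f(r) = r^3 + a r sends U to V and is injective on U by the two preceding
lemmas.  For a != 0 multiplication by a is a bijection from U to V, and for
a = 0 these sets coincide; hence f maps U onto V. *)
Lemma cubic_unique_root (a b : F) : b != 0 ->
  trace_char (1 + a ^+ 3 / b ^+ 2) != 1 ->
  #|[set z : F | z ^+ 3 + a * z == b]| = 1%N.
Proof.
move=> b0 trb; pose f (r : F) := r ^+ 3 + a * r.
pose U := [set r : F | (r != 0) && (trace_char (1 + a / r ^+ 2) != 1)].
pose V := [set d : F | (d != 0) && (trace_char (1 + a ^+ 3 / d ^+ 2) != 1)].
have f_neq0 r : r \in U -> f r != 0.
  rewrite inE => /andP[r0]; apply: contra => /eqP fr0.
  apply/eqP/(cubic_two_roots_trace (s := 0) r0); first by rewrite eq_sym.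
  (* 0 is another root of z ^+ 3 + a * z *)
  by rewrite -/(f r) fr0 expr0n mulr0 addr0.
have f_inj : {in U &, injective f}.
  move=> r s rU sU fE; apply: contraTeq rU => nrs.
  rewrite inE negb_and !negbK.
  have [->|r0 /=] := eqVneq r 0; first by rewrite !expr0n.
  by apply/eqP/(cubic_two_roots_trace (s := s)) => //; rewrite eq_sym.
have fUV : f @: U \subset V.
  apply/subsetP=> _ /imsetP[r rU ->].
  by move: (rU); rewrite !inE f_neq0 //= => /andP[_]; rewrite cubic_root_trace // f_neq0.
have cUV : #|U| = #|V|.
  have [a0|a0] := eqVneq a 0.
    by apply: eq_card => x; rewrite !inE a0 expr0n !mul0r.
  rewrite -(card_imset U (mulfI a0)); apply: eq_card => x.
  apply/imsetP/idP => [[r + ->]|].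
    rewrite !inE mulf_eq0 (negPf a0) /= => /andP[r0 tr]; rewrite r0 /=.
    by rewrite (_ : _ / _ = a / r ^+ 2) //; field; rewrite a0 r0.
  rewrite inE => /andP[x0 tr]; exists (x / a); last by field.
  rewrite inE mulf_eq0 invr_eq0 negb_or x0 a0 /=.
  by rewrite (_ : a / _ = a ^+ 3 / x ^+ 2) //; field; rewrite a0 x0.
have bV : b \in f @: U.
  suff -> : f @: U = V by rewrite inE b0.
  by apply/eqP; rewrite eqEcard fUV card_in_imset // cUV /=.
have [r rU bE] := imsetP bV; apply/eqP/cards1P; exists r.
apply/setP=> z; rewrite !inE bE; apply/eqP/eqP => [fE|-> //].
apply: contraTeq rU => nzr; rewrite inE negb_and !negbK.
have [//|r0 /=] := eqVneq r 0.
by apply/eqP/(cubic_two_roots_trace (s := z)).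
Qed.

End Char2.

(** * The isogeny of degree 3 *)

Section Isogeny.

Variables (m : nat) (F : finFieldType).
Hypothesis cardF : #|F| = (2 ^ m)%N.
Variables (t s : F).
Hypotheses (t0 : t != 0) (t1 : t + 1 != 0) (sE : s ^+ 2 = t ^+ 2 + t).

Notation chi := (trace_char m).
Let A := t ^+ 3 * (t + 1).
Let B := t * (t + 1) ^+ 3.

(** Velu's isogeny with kernel of abscissa t, read on abscissas.  In partial
fractions it is x + t / (x + t) + (t / (x + t))^2. *)
Definition isog (x : F) := x * (x ^+ 2 + t ^+ 2 + t) / (x + t) ^+ 2.

Let ch2 := char2 cardF.
Let p0 : t ^+ 2 + t != 0.
Proof. by rewrite (_ : _ + _ = t * (t + 1)) ?mulf_neq0 //; ring. Qed.
Let s0 : s != 0.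
Proof. by rewrite -sqrf_eq0 sE. Qed.
Let st : s != t.
Proof.
apply: contra t0 => /eqP st; apply/eqP.
by rewrite -[LHS](addKr (t ^+ 2)) -sE st addNr.
Qed.

(* The complement of the preimages of 0 and infinity under isog: since
   s^2 = t^2 + t, the numerator of isog x is x (x + s)^2. *)
Let D := [pred x : F | [&& x != 0, x != s & x != t]].

Let in_D (x : F) : x \in D ->
  [/\ x != 0, x + t != 0 & x ^+ 2 + t ^+ 2 + t != 0].
Proof.
rewrite inE => /and3P[x0 xs xt]; split=> //; first by rewrite (addr_eq0_char2 cardF).
rewrite -addrA -sE (_ : _ + _ = (x + s) ^+ 2) ?sqrf_eq0 ?(addr_eq0_char2 cardF) //.
by char2_ring ch2.
Qed.

Lemma isog_neq0 (x : F) : x \in D -> isog x != 0.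
Proof.
by move=> /in_D[x0 xt xs]; rewrite !mulf_neq0 // invr_eq0 sqrf_eq0.
Qed.

(** Both isog x + x and B / (isog x)^2 + A / x^2 have the form w^2 + w, with
w = t / (x + t) and w = (t^2 + t) / (x^2 + t^2 + t) respectively. *)
Lemma trace_char_isog (x : F) : x \in D ->
  chi (isog x + B / isog x ^+ 2) = chi (x + A / x ^+ 2).
Proof.
move=> /in_D[x0 xt Q0].
set p := t ^+ 2 + t; set Q := x ^+ 2 + t ^+ 2 + t in Q0.
have isogE : isog x = x + ((t / (x + t)) ^+ 2 + t / (x + t)).
  rewrite /isog -/Q [RHS](_ : _ = (x * (x + t) ^+ 2 + t ^+ 2 + t * (x + t)) / (x + t) ^+ 2).
    by congr (_ / _); rewrite /Q; char2_ring ch2.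
  by field.
have B_isogE : B / isog x ^+ 2 = A / x ^+ 2 + ((p / Q) ^+ 2 + p / Q).
  rewrite /isog -/Q [LHS](_ : _ = B * (x + t) ^+ 4 / (x ^+ 2 * Q ^+ 2)); last first.
    by field; rewrite x0 xt Q0.
  rewrite [RHS](_ : _ = (A * Q ^+ 2 + x ^+ 2 * (p ^+ 2 + p * Q)) / (x ^+ 2 * Q ^+ 2)).
    have -> : (x + t) ^+ 4 = x ^+ 4 + t ^+ 4 by char2_ring ch2.
    by congr (_ / _); rewrite /A /B /Q /p; char2_ring ch2.
  by field; rewrite x0 Q0.
by rewrite !(trace_charD cardF) B_isogE isogE !(trace_char_addAS cardF).
Qed.

(** Clearing denominators in isog x = y gives a cubic in x with quadratic
coefficient y, which the translation z = x + y removes. *)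
Lemma isog_fiberE (x y : F) : y != 0 ->
  (x \in D) && (isog x == y) =
  ((x + y) ^+ 3 + (y ^+ 2 + (t ^+ 2 + t)) * (x + y) == t * y).
Proof.
move=> y0; rewrite -[RHS](addr_eq0_char2 cardF).
rewrite [X in _ = (X == 0)](_ : _ = x * (x ^+ 2 + t ^+ 2 + t) + y * (x + t) ^+ 2); last first.
  by char2_ring ch2.
rewrite (addr_eq0_char2 cardF); apply/andP/eqP => [[xD /eqP <-]|E].
  by have [x0 xt xs] := in_D xD; rewrite /isog divfK ?expf_neq0.
have xt : x + t != 0.
  apply: contra t0; rewrite (addr_eq0_char2 cardF) => /eqP xt.
  rewrite -sqrf_eq0 (_ : t ^+ 2 = x * (x ^+ 2 + t ^+ 2 + t) + y * (x + t) ^+ 2).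
    by rewrite E -mulr2n -mulr_natr ch2 mulr0.
  by rewrite xt; char2_ring ch2.
have n0 : x * (x ^+ 2 + t ^+ 2 + t) != 0 by rewrite E mulf_neq0 ?expf_neq0.
split; last by rewrite /isog E mulfK ?expf_neq0.
move: n0; rewrite mulf_eq0 negb_or inE => /andP[-> xs] /=.
rewrite -[x == t](addr_eq0_char2 cardF) xt andbT.
by apply: contra xs => /eqP->; rewrite -addrA -sE -mulr2n -mulr_natr ch2 mulr0.
Qed.

(** The resolvent 1 + a^3 / b^2 of the fiber cubic, with a = y^2 + t^2 + t and
b = t y, has the same trace as (y + B / y^2) + t.  So the fiber is a single
point unless the character takes the same value at y + B / y^2 and at t. *)
Lemma isog_fiber_count (y : F) : y != 0 ->
  chi (y + B / y ^+ 2) * (#|[pred x in D | isog x == y]|%:R - 1)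
  = chi t * (#|[pred x in D | isog x == y]|%:R - 1).
Proof.
move=> y0.
have [E|nE] := eqVneq (chi (y + B / y ^+ 2 + t)) 1.
  by rewrite (trace_char_eq cardF E).
suff -> : #|[pred x in D | isog x == y]| = 1%N by rewrite subrr !mulr0.
set a := y ^+ 2 + (t ^+ 2 + t).
have <- : #|[set z : F | z ^+ 3 + a * z == t * y]| = 1%N.
  apply: (cubic_unique_root cardF); first exact: mulf_neq0.
  apply: contra nE => /eqP<-; apply/eqP; rewrite /a /B.
  rewrite -(trace_char_addAS cardF _ (y ^+ 2 / t + y + t)); congr chi.
  char2_field ch2; by rewrite t0 y0.
rewrite -(card_preimset _ (addIr y)); apply: eq_card => x.
by rewrite !inE -isog_fiberE.
Qed.

(** Both sums are compared over D: the two terms at s and t that the first one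
has besides D compensate exactly for the deficit of 2 points of D with respect
to the nonzero y. *)
Lemma kloosterman_isog :
  kloosterman m (t ^+ 3 * (t + 1)) = kloosterman m (t * (t + 1) ^+ 3).
Proof.
rewrite !(kloostermanE cardF) -/A -/B.
have tt : chi (t + A / t ^+ 2) = chi t.
  rewrite -(trace_char_sqr cardF t); congr chi; rewrite /A; char2_field ch2; exact: t0.
have ss : chi (s + A / s ^+ 2) = chi t.
  have <- : chi (s + s ^+ 2 + t) = chi t.
    by rewrite [s + _]addrC (trace_charD cardF) (trace_char_AS cardF) mul1r.
  congr chi; rewrite /A sE; char2_field ch2.
  by rewrite (_ : t * t + t = t ^+ 2 + t).
have SD (g : F -> int) :
    \sum_(x : F | x != 0) g x = g s + g t + \sum_(x in D) g x.
  rewrite (bigD1 s) //= (bigD1 t) /=; last by rewrite t0 eq_sym.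
  rewrite addrA; congr (_ + _); apply: eq_bigl => x.
  by rewrite inE -andbA.
have fib (g : F -> int) : \sum_(x in D) g (isog x)
    = \sum_(y : F | y != 0) g y * #|[pred x in D | isog x == y]|%:R.
  rewrite (partition_big isog (fun y => y != 0)) /=; last exact: isog_neq0.
  apply: eq_bigr => y _; rewrite mulr_natr -sumr_const.
  by apply: eq_bigr => x /andP[_ /eqP->].
apply/eqP; rewrite -subr_eq0 SD tt ss.
rewrite -(eq_bigr _ trace_char_isog) (fib (fun y => chi (y + B / y ^+ 2))) -addrA -sumrB.
under eq_bigr => y y0.
  rewrite -[X in _ - X]mulr1 -mulrBr isog_fiber_count // mulrBr mulr1.
  over.
rewrite sumrB -(fib (fun=> chi t)) addrA -(SD (fun=> chi t)).
by rewrite subrr.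
Qed.

End Isogeny.

Theorem theorem4 (m : nat) (F : finFieldType) (c : F) (n : rat) (cn : F) :
  (0 < m)%N ->
  #|F| = (2 ^ m)%N ->
  is_ratpow c n cn ->
  cn ^+ 4 + 1 != 0 ->
  (c * cn + cn) ^+ 3 * (c * cn + 1) / (cn ^+ 4 + 1) != 0 ->
  (c * cn + cn) * (c * cn + 1) ^+ 3 / (cn ^+ 4 + 1) != 0 ->
  kloosterman m ((c * cn + cn) ^+ 3 * (c * cn + 1) / (cn ^+ 4 + 1))
  = kloosterman m ((c * cn + cn) * (c * cn + 1) ^+ 3 / (cn ^+ 4 + 1)).
Proof.
move=> _ cardF _ + + _; set a := c * cn + cn; set b := c * cn + 1.
have ch2 := char2 cardF.
have ab : cn + 1 = a + b by rewrite /a /b; char2_ring ch2.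
have -> : cn ^+ 4 + 1 = (a + b) ^+ 4 by rewrite -ab; char2_ring ch2.
rewrite expf_eq0 /= => d0.
rewrite mulf_eq0 mulf_eq0 expf_eq0 /= !negb_or => /andP[/andP[a0 b0] _].
pose t := a / (a + b).
have t1E : t + 1 = b / (a + b) by rewrite /t; char2_field ch2.
have [s sE] := sqrt_char2 cardF (t ^+ 2 + t).
have t0 : t != 0 by rewrite mulf_neq0 ?invr_eq0.
have t1 : t + 1 != 0 by rewrite t1E mulf_neq0 ?invr_eq0.
have <- : t ^+ 3 * (t + 1) = a ^+ 3 * b / (a + b) ^+ 4 by rewrite t1E /t; field.
have <- : t * (t + 1) ^+ 3 = a * b ^+ 3 / (a + b) ^+ 4 by rewrite t1E /t; field.
exact (kloosterman_isog cardF t0 t1 sE).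
Qed.
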